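(* Let $\mathcal{H},\mathcal{G}$ be real Hilbert spaces, let $f\colon\mathcal{H}\to\mathbb{R}\cup\{\infty\}$ and $g\colon\mathcal{G}\to\mathbb{R}\cup\{\infty\}$ be proper, convex, and lower semicontinuous, let $L\colon\mathcal{H}\to\mathcal{G}$ be a nonzero bounded linear operator, and assume that there exists at least one KKT point. Let $(x_\star,y_\star)\in\mathcal{H}\times\mathcal{G}$ be an arbitrary KKT point. Let $\theta\ge 1/2$ and $\tau,\sigma>0$ satisfy $\tau\sigma\|L\|^2\le 4/(1+2\theta)$, and suppose that at least one of the two inequalities $\theta\ge 1/2$ and $\tau\sigma\|L\|^2\le 4/(1+2\theta)$ holds strictly. Let $(x_0,y_0)\in\mathcal{H}\times\mathcal{G}$ be arbitrary and let $(x_k)_{k=0}^\infty$, $(y_k)_{k=0}^\infty$ be generated by the Chambolle--Pock iteration with parameters $\tau,\sigma,\theta$. For each positive integer $K$ let $\bar{x}_K=\frac{1}{K}\sum_{k=1}^K x_k$ and $\bar{y}_K=\frac{1}{K}\sum_{k=1}^K y_k$. Then the ergodic primal--dual gap $\mathcal{D}_{x_\star,y_\star}(\bar{x}_K,\bar{y}_K)$ converges to zero as $\mathcal{O}(1/K)$, i.e., there is a constant $C\ge 0$ independent of $K$ such that $0\le \mathcal{D}_{x_\star,y_\star}(\bar{x}_K,\bar{y}_K)\le C/K$ for each positive integer $K$.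
   Context: $\|L\|$ is the operator norm and $L^*$ the adjoint of $L$. The convex conjugate of $g$ is $g^*(u)=\sup_{y\in\mathcal{G}}(\langle u,y\rangle-g(y))$. The subdifferential of a proper convex lower semicontinuous $h$ is $\partial h(x)=\{u : h(z)\ge h(x)+\langle u,z-x\rangle \text{ for all } z\}$, and its proximal operator with step size $\gamma>0$ is $\mathrm{Prox}^{\gamma}_{h}(x)=\operatorname{argmin}_{z}\left(h(z)+\frac{1}{2\gamma}\|z-x\|^2\right)$ (uniquely defined). A KKT point is a pair $(x_\star,y_\star)\in\mathcal{H}\times\mathcal{G}$ with $-L^*y_\star\in\partial f(x_\star)$ and $Lx_\star\in\partial g^*(y_\star)$. The Chambolle--Pock iteration is, for $k=0,1,2,\dots$, $$x_{k+1}=\mathrm{Prox}^{\tau}_{f}(x_k-\tau L^*y_k),\qquad y_{k+1}=\mathrm{Prox}^{\sigma}_{g^*}\bigl(y_k+\sigma L(x_{k+1}+\theta(x_{k+1}-x_k))\bigr).$$ The Lagrangian is $\mathcal{L}(x,y)=f(x)+\langle y,Lx\rangle-g^*(y)$. For a KKT point $(x_\star,y_\star)$, the primal--dual gap function $\mathcal{D}_{x_\star,y_\star}\colon\mathcal{H}\times\mathcal{G}\to\mathbb{R}\cup\{\infty\}$ is $\mathcal{D}_{x_\star,y_\star}(x,y)=\mathcal{L}(x,y_\star)-\mathcal{L}(x_\star,y)$. *)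

(* Defs.v *)
From HB Require Import structures.
From mathcomp Require Import all_boot all_order all_algebra.
From mathcomp Require Import all_classical all_reals.
From mathcomp Require Import ereal topology normedtype.

Set Implicit Arguments.
Unset Strict Implicit.
Unset Printing Implicit Defensive.

Import Order.TTheory GRing.Theory Num.Theory.
Import numFieldNormedType.Exports.

Local Open Scope classical_set_scope.
Local Open Scope ring_scope.

HB.mixin Record CompleteNormedModule_isHilbert (R : realType) (V : Type)
    of CompleteNormedModule R V := {
  inner : {dot V for @idfun R} ;
  inner_norm : forall x : V, inner x x = `|x| ^+ 2
}.

#[short(type="hilbertType")]
HB.structure Definition Hilbert (R : realType) :=
  {V of CompleteNormedModule R V & CompleteNormedModule_isHilbert R V}.

Section BoundedLinear.
Context {R : realType} {H G : hilbertType R}.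
Implicit Type L : {linear H -> G}.

Definition opnorm L : R := sup [set `|L x| | x in [set x | `|x| <= 1]].

(* The default value of xget is used only if no adjoint vector exists, which by
   Riesz representation never happens when L is bounded. *)
Definition adjoint L (y : G) : H :=
  xget 0 [set z | forall x, inner (L x) y = inner x z].

End BoundedLinear.

(* A function V -> R \cup {+oo} is rendered as h : V -> \bar R together with
   the first conjunct of [proper_efun]. *)
Section ConvexAnalysis.
Context {R : realType} {V : hilbertType R}.
Implicit Types (h : V -> \bar R) (x u : V).
Local Open Scope ereal_scope.

Definition proper_efun h := (forall x, h x != -oo) /\ (exists x, h x != +oo).

(* In \bar R, 0 * +oo = 0, so the endpoints t = 0 and t = 1 add nothing to the
   usual inequality. *)
Definition convex_efun h := forall (x z : V) (t : R), (0 <= t <= 1)%R ->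
  h (t *: x + (1 - t) *: z)%R <= t%:E * h x + (1 - t)%:E * h z.

Definition conjugate h u : \bar R :=
  ereal_sup [set (inner u z)%:E - h z | z in [set: V]].

Definition subdifferential h x : set V :=
  [set u | forall z, h x + (inner u (z - x))%:E <= h z].

Definition argmin h : set V := [set x | forall z, h x <= h z].

(* For h proper, convex and lower semicontinuous and gamma > 0 this argmin is a
   singleton, so that the default value of xget is irrelevant. *)
Definition prox (gamma : R) h x : V :=
  xget 0%R (argmin (fun z => h z + ((2 * gamma)^-1 * `|z - x| ^+ 2)%:E)).

End ConvexAnalysis.

Section PrimalDual.
Context {R : realType} {H G : hilbertType R}.
Implicit Types (f : H -> \bar R) (g : G -> \bar R) (L : {linear H -> G}).

Definition kkt_point f g L (xs : H) (ys : G) :=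
  subdifferential f xs (- adjoint L ys) /\
  subdifferential (conjugate g) ys (L xs).

Definition chambolle_pock f g L (tau sigma theta : R)
    (x : nat -> H) (y : nat -> G) := forall k,
  x k.+1 = prox tau f (x k - tau *: adjoint L (y k)) /\
  y k.+1 = prox sigma (conjugate g)
             (y k + sigma *: L (x k.+1 + theta *: (x k.+1 - x k))).

Local Open Scope ereal_scope.

Definition lagrangian f g L (x : H) (y : G) : \bar R :=
  f x + (inner y (L x))%:E - conjugate g y.

Definition pd_gap f g L (xs : H) (ys : G) (x : H) (y : G) : \bar R :=
  lagrangian f g L x ys - lagrangian f g L xs y.

End PrimalDual.

(* The mean of the iterates of index 1, ..., K; the initial point is excluded. *)
Definition ergodic_mean {R : realType} {V : hilbertType R}
    (x : nat -> V) (K : nat) : V :=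
  K%:R^-1 *: \sum_(1 <= k < K.+1) x k.

(* Main.v *)
(* With xs = ys = 0 and tau = sigma = 1 in the notation, write F and D for the
   primal part of the gap and the gap itself at the iterates, and
     w_k = (x_k - x_(k-1)) - L^*(y_k - y_(k-1)),
     V_k = |x_k|^2/2 + |y_k|^2/2 - <L x_k, y_k> + (theta - 1) F_k + |w_k|^2/4.
   Adding the subgradient inequality of f at x_(k+1) tested at xs, that of g^*
   at y_(k+1) tested at ys, theta - 1/2 times that of f at x_(k+1) tested at x_k
   and 1/2 times that of f at x_k tested at x_(k+1) gives
   D_(k+1) <= V_k - V_(k+1) up to squares and the slack in the step-size
   condition. The form V_k is indefinite, but adding 1/2 times the subgradient
   inequality of f at x_k tested at xs yields V_k >= 0. So the gaps are
   summable, and convexity turns this into the ergodic rate.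

   Everything about Hilbert spaces comes from the proximal map: a proper convex
   lsc function decreases at most linearly, so the proximal objective is bounded
   below and its minimizing sequences are Cauchy; the prox of g at 0 gives an
   affine minorant of g, hence properness of g^*, and the prox of a bounded
   linear functional at 0 represents it, hence the existence of adjoints. *)
Require Import Defs.
From mathcomp Require Import all_boot all_order all_algebra.
From mathcomp Require Import all_classical all_reals.
From mathcomp Require Import ereal topology normedtype.
From mathcomp Require Import ring lra.

Set Implicit Arguments.
Unset Strict Implicit.
Unset Printing Implicit Defensive.

Import Order.TTheory GRing.Theory Num.Theory.
Import numFieldNormedType.Exports.

Local Open Scope classical_set_scope.
Local Open Scope ring_scope.

(** * Inner product algebra, Cauchy-Schwarz and continuity *)

Section InnerProduct.
Context {R : realType} {V : hilbertType R}.
Implicit Types x y z : V.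

Lemma innerC x y : inner x y = inner y x.
Proof. by rewrite (hermC (inner : {dot V for idfun})) expr0 mul1r. Qed.

Lemma innerDl x y z : inner (x + y) z = inner x z + inner y z.
Proof. exact: linearDl. Qed.

Lemma innerNl x y : inner (- x) y = - inner x y.
Proof. exact: linearNl. Qed.

Lemma innerZl (a : R) x y : inner (a *: x) y = a * inner x y.
Proof. exact: linearZl_LR. Qed.

Lemma innerDr x y z : inner x (y + z) = inner x y + inner x z.
Proof. by rewrite innerC innerDl !(innerC x). Qed.

Lemma innerNr x y : inner x (- y) = - inner x y.
Proof. by rewrite innerC innerNl (innerC x). Qed.

Lemma innerZr (a : R) x y : inner x (a *: y) = a * inner x y.
Proof. by rewrite innerC innerZl (innerC x). Qed.

Definition innerE :=
  (innerDl, innerDr, innerNl, innerNr, innerZl, innerZr).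

Lemma inner_ge0 x : 0 <= inner x x.
Proof. by rewrite inner_norm sqr_ge0. Qed.

Lemma cauchy_schwarz x y : `|inner x y| <= `|x| * `|y|.
Proof.
have [->|y0] := eqVneq y 0; first by rewrite -(scale0r 0) innerZr mul0r scale0r !normr0 mulr0.
have y2_gt0 : 0 < inner y y by rewrite inner_norm exprn_gt0// normr_gt0.
rewrite -(ler_pXn2r (_ : 0 < 2)%N) ?nnegrE ?mulr_ge0//.
rewrite exprMn -!inner_norm real_normK ?num_real//.
(* This square expands to [inner y y] times |x|^2 |y|^2 - <x, y>^2. *)
have := inner_ge0 (inner y y *: x - inner x y *: y).
rewrite !innerE (innerC y x) => ge0.
rewrite -subr_ge0 -(pmulr_rge0 _ y2_gt0).
by apply: le_trans ge0 _; rewrite le_eqVlt; apply/orP; left; apply/eqP; ring.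
Qed.

Lemma continuous_innerl y : continuous (inner ^~ y).
Proof.
move=> x; apply/cvgrPdist_lt => e e0; near=> z.
rewrite -innerNl -innerDl; apply: le_lt_trans (cauchy_schwarz _ _) _.
have y1 : 0 < `|y| + 1 by rewrite ltr_pwDr.
apply: (@le_lt_trans _ _ (`|x - z| * (`|y| + 1))).
  by rewrite ler_wpM2l// lerDl.
rewrite -ltr_pdivlMr//; near: z.
by apply: (@cvgr_dist_lt _ _ _ (nbhs x) _ id x) => //; exact: divr_gt0.
Unshelve. all: by end_near. Qed.

End InnerProduct.

Lemma lower_semicontinuous_EFin (R : realType) (T : topologicalType)
  (phi : T -> R) : continuous phi -> lower_semicontinuous (fun x => (phi x)%:E).
Proof.
move=> cphi x a; rewrite lte_fin => ax.
exists (phi @^-1` [set t | a < t]) => [|y /=]; last by rewrite lte_fin.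
by apply: cphi; apply: open_nbhs_nbhs; split => //; exact: open_gt.
Qed.

(** * Existence of proximal points and their subgradient inequality *)

Section Prox.
Context {R : realType} {V : hilbertType R}.
Implicit Types (h : V -> \bar R) (x u : V).

Lemma convex_efun_fin h x z (a b t : R) : convex_efun h -> 0 <= t <= 1 ->
  (h x <= a%:E)%E -> (h z <= b%:E)%E ->
  (h (t *: x + (1 - t) *: z)%R <= (t * a + (1 - t) * b)%:E)%E.
Proof.
move=> hc t01 hx hz; have /andP[t0 t1] := t01.
apply: (le_trans (hc _ _ _ t01)).
apply: (@le_trans _ _ (t%:E * a%:E + (1 - t)%:E * b%:E)%E) => //.
by rewrite leeD// lee_wpmul2l// lee_fin ?subr_ge0.
Qed.

Lemma proper_efun_point h : proper_efun h -> exists x (a : R), h x = a%:E.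
Proof. by move=> [hNy [x]]; case hx: (h x) (hNy x) => [a||] // _ _; exists x, a. Qed.

(** Lower semicontinuity keeps [h] above [a - 1] on a ball around a point [z0] of its domain. If [h]
    fell below the cone at some [z] outside, convexity on the segment from [z0] to [z] would force
    it below [a - 1] inside the ball. *)
Lemma convex_lsc_minorant h :
  proper_efun h -> convex_efun h -> lower_semicontinuous h ->
  exists z0 (b c : R), 0 <= c /\ forall z, ((b - c * `|z - z0|)%:E <= h z)%E.
Proof.
move=> hp hc hl; have [z0 [a ha]] := proper_efun_point hp.
have [|U /nbhs_ballP[e /= e0 eU] hU] := hl z0 (a - 1).
  by rewrite ha lte_fin ltrBlDr ltrDl.
exists z0, (a - 1), (2 / e); split => [|z]; first by rewrite divr_ge0// ltW.
have hball w : `|w - z0| < e -> ((a - 1)%:E < h w)%E.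
  by move=> w0; apply/hU/eU; rewrite -ball_normE /ball_ /= distrC.
rewrite leNgt; apply/negP => hz.
have [lt_e|ge_e] := ltP `|z - z0| e.
  have := lt_trans (hball _ lt_e) hz.
  by rewrite lte_fin ltNge gerBl mulr_ge0// divr_ge0// ltW.
have d0 : 0 < `|z - z0| by apply: lt_le_trans ge_e.
(* The convex combination with weight [t] lies at distance [e / 2] from [z0], and the slope [2 / e]
   turns the interpolated bound into [a - 1 - t]. *)
pose t := e / 2 / `|z - z0|.
have t0 : 0 < t by rewrite !divr_gt0.
have t1 : t <= 1 by rewrite ler_pdivrMr// mul1r; lra.
have := @convex_efun_fin _ z z0 _ a t hc _ (ltW hz) _.
rewrite ha lexx (ltW t0) t1 => /(_ isT isT) /=; apply/negP; rewrite -ltNge.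
have -> : t * (a - 1 - 2 / e * `|z - z0|) + (1 - t) * a = a - 1 - t.
  by rewrite /t; field; rewrite !gt_eqF.
apply: le_lt_trans (hball _ _); first by rewrite lee_fin gerBl ltW.
have -> : t *: z + (1 - t) *: z0 - z0 = t *: (z - z0).
  by rewrite scalerBl scale1r scalerBr addrCA [LHS]addrC addKr.
by rewrite normrZ gtr0_norm// /t divfK ?gt_eqF//; lra.
Qed.

(** The quadratic absorbs the linear decrease of [h]: complete the square in [|z - x|]. *)
Lemma prox_objective_lb h x (k : R) :
  proper_efun h -> convex_efun h -> lower_semicontinuous h -> 0 < k ->
  exists m : R, forall z, (m%:E <= h z + (k * `|z - x| ^+ 2)%:E)%E.
Proof.
move=> hp hc hl k0; have [z0 [b [c [c0 hz]]]] := convex_lsc_minorant hp hc hl.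
exists (b - c * `|x - z0| - c ^+ 2 / (4 * k)) => z.
apply: le_trans (leeD2r _ (hz z)); rewrite -EFinD lee_fin.
have tri : `|z - z0| <= `|z - x| + `|x - z0|.
  by apply: le_trans (ler_normD _ _); rewrite addrA subrK.
have sq : 0 <= k * (`|z - x| - c / (2 * k)) ^+ 2 by rewrite mulr_ge0 ?sqr_ge0 ?ltW.
have E : k * (`|z - x| - c / (2 * k)) ^+ 2 =
  k * `|z - x| ^+ 2 - c * `|z - x| + c ^+ 2 / (4 * k) by field; rewrite gt_eqF.
by have := ler_wpM2l c0 tri; rewrite E in sq; lra.
Qed.

Lemma prox_objective_argmin h x (k : R) :
  proper_efun h -> convex_efun h -> lower_semicontinuous h -> 0 < k ->
  exists p, argmin (fun z => h z + (k * `|z - x| ^+ 2)%:E)%E p.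
Proof.
move=> hp hc hl k0; have [m0 hm0] := prox_objective_lb x hp hc hl k0.
(* Real upper bounds of objective values, so that the infimum is taken in [R]; the quadratic stands
   on the right to suit [convex_efun_fin]. *)
pose S := [set r : R | exists z, (h z <= (r - k * `|z - x| ^+ 2)%:E)%E].
have Sinf : has_inf S.
  split.
    have [z [a hz]] := proper_efun_point hp.
    by exists (a + k * `|z - x| ^+ 2), z; rewrite addrK hz.
  exists m0 => r [z hz]; rewrite -lee_fin; apply: le_trans (hm0 z) _.
  by apply: le_trans (leeD2r _ hz) _; rewrite -EFinD subrK.
pose m := inf S; have Slb : lbound S m by exact: ge_inf Sinf.2.
have /choice[z hz] n : exists z, (h z <= (m + n.+1%:R^-1 - k * `|z - x| ^+ 2)%:E)%E.
  have [|r [z hz] rm] := inf_adherent _ Sinf (eps := n.+1%:R^-1).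
    by rewrite invr_gt0.
  by exists z; apply: le_trans hz _; rewrite lee_fin lerD2r ltW.
(* The parallelogram law at the midpoint makes the minimizing sequence Cauchy. *)
have zdist i j : k / 4 * `|z i - z j| ^+ 2 <= (i.+1%:R^-1 + j.+1%:R^-1) / 2.
  pose w := (2^-1 : R) *: z i + (1 - 2^-1 : R) *: z j.
  have := convex_efun_fin hc _ (hz i) (hz j) (t := 2^-1).
  have -> : 0 <= (2^-1 : R) <= 1 by lra.
  move=> /(_ isT); rewrite -/w => hw.
  have : S (m + (i.+1%:R^-1 + j.+1%:R^-1) / 2 - k / 4 * `|z i - z j| ^+ 2).
    exists w; apply: le_trans hw _; rewrite lee_fin le_eqVlt; apply/orP; left.
    rewrite /w -!inner_norm !innerE (innerC (z j) (z i)) (innerC x (z i)) (innerC x (z j)).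
    by apply/eqP; field; rewrite !nat1r !pnatr_eq0.
  by move=> /Slb; rewrite -addrA lerDl subr_ge0.
have inv_lt (e : R) : 0 < e -> \forall n \near \oo, n.+1%:R^-1 < e.
  by move=> e0; exact: (near_infty_natSinv_lt (PosNum e0)).
have /cauchy_cvgP/cvg_ex[p zp] : cauchy (z @ \oo).
  apply: cauchy_exP => e e0.
  have ke : 0 < k / 4 * e ^+ 2 by rewrite mulr_gt0 ?divr_gt0 ?exprn_gt0.
  have [N _ hN] := inv_lt _ ke.
  exists (z N); exists N => // n /= Nn; rewrite -ball_normE /ball_ /=.
  rewrite -(@ltr_pXn2r _ 2)// ?nnegrE ?(ltW e0)// -(ltr_pM2l (_ : 0 < k / 4)) ?divr_gt0//.
  apply: le_lt_trans (zdist _ _) _.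
  have /= := hN _ Nn; have /= := hN _ (leqnn N).
  by rewrite ltr_pdivrMr// mulr_natr mulr2n => hA hB; exact: ltrD.
(* Otherwise a real [a] lies strictly between the two sides; lower semicontinuity keeps [h] above
   [a] near [p], while the bounds on [h (z n)] eventually drop below [a]. *)
have hpm : (h p <= (m - k * `|p - x| ^+ 2)%:E)%E.
  rewrite leNgt; apply/negP => hgt.
  have [a hpa ahp] : exists2 a, m - k * `|p - x| ^+ 2 < a & (a%:E < h p)%E.
    move: hgt; case: (h p) => [r||] //; rewrite ?lte_fin => hgt.
      by exists ((m - k * `|p - x| ^+ 2 + r) / 2); rewrite ?lte_fin; lra.
    by exists (m - k * `|p - x| ^+ 2 + 1); rewrite ?ltry// ltrDl.
  have [U Up hU] := hl _ _ ahp.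
  have kcvg : (m - k * `|z n - x| ^+ 2) @[n --> \oo] --> m - k * `|p - x| ^+ 2.
    apply: cvgB; first exact: cvg_cst.
    apply: cvgM; first exact: cvg_cst.
    by apply: cvgM; apply: cvg_norm; apply: cvgB => //; exact: cvg_cst.
  pose d := a - (m - k * `|p - x| ^+ 2); have d2 : 0 < d / 2 by rewrite /d; lra.
  have [n [Un [nd knd]]] : exists n, U (z n) /\ n.+1%:R^-1 < d / 2 /\
      m - k * `|z n - x| ^+ 2 < m - k * `|p - x| ^+ 2 + d / 2.
    apply: (@filter_ex _ \oo); near=> n; split; first by near: n; exact: zp.
    split; first by near: n; exact: inv_lt.
    by near: n; apply: (cvgr_lt _ kcvg); rewrite ltrDl.
  have := lt_le_trans (hU _ Un) (hz n); rewrite lte_fin.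
  by rewrite /d in nd knd; move: nd knd; move: (_^-1) => q; lra.
exists p => w; case hw: (h w) => [r||]; last by have := hp.1 w; rewrite hw.
  apply: le_trans (leeD2r _ hpm) _; rewrite -!EFinD lee_fin subrK.
  by apply: Slb; exists w; rewrite hw addrK.
by rewrite addye// leey.
Unshelve. all: by end_near. Qed.

Lemma subdifferential_fin_num h x u :
  proper_efun h -> subdifferential h x u -> h x \is a fin_num.
Proof.
move=> hp hu; have [z [a hz]] := proper_efun_point hp.
by have := hu z; have := hp.1 x; rewrite hz; case: (h x).
Qed.

(** Comparing [p] with [t *: z + (1 - t) *: p] and dividing by [t] gives the subgradient inequality
    up to the error [t * k * |z - p|^2], which a small [t] makes at most [e]. *)
Lemma argmin_subdifferential h x (k : R) p : proper_efun h -> convex_efun h ->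
  argmin (fun z => h z + (k * `|z - x| ^+ 2)%:E)%E p ->
  subdifferential h p ((2 * k) *: (x - p)).
Proof.
move=> hp hc pmin; have [z0 [a0 hz0]] := proper_efun_point hp.
have [a ha] : exists a, h p = a%:E.
  by have := pmin z0; have := hp.1 p; rewrite hz0; case: (h p) => // a _ _; exists a.
move=> z; rewrite ha; case hz: (h z) => [b||]; last by have := hp.1 z; rewrite hz.
  rewrite -EFinD lee_fin; apply/ler_addgt0Pr => e e0.
  pose D := k * `|z - p| ^+ 2.
  pose t := Num.min 1 (e / (`|D| + 1)).
  have D1 : 0 < `|D| + 1 by rewrite ltr_pwDr.
  have t0 : 0 < t by rewrite lt_min ltr01 divr_gt0.
  have t1 : t <= 1 by rewrite ge_min lexx.
  have tD : t * D <= e.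
    apply: (@le_trans _ _ (t * (`|D| + 1))).
      by rewrite ler_pM2l// (le_trans (ler_norm _))// lerDl.
    by rewrite -ler_pdivlMr// ge_min lexx orbT.
  have := pmin (t *: z + (1 - t) *: p).
  have := @convex_efun_fin _ z p b a t hc _ _ _.
  rewrite ha hz !lexx (ltW t0) t1 => /(_ isT isT isT) hw pw.
  have := le_trans pw (leeD2r _ hw); rewrite -!EFinD lee_fin.
  have -> : t *: z + (1 - t) *: p - x = t *: (z - p) + (p - x).
    by rewrite scalerBl scale1r scalerBr !addrA; congr (_ - _); rewrite addrAC.
  rewrite /D in tD *; rewrite -!inner_norm in tD *.
  rewrite !innerE in tD *; rewrite !(innerC x) (innerC p z) in tD *.
  move=> H; rewrite -(ler_pM2l t0).
  by rewrite -(ler_pM2l t0) in tD; lra.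
by rewrite leey.
Qed.

(** A minimizer exists, so [xget] returns a point of the argmin and not its default. *)
Lemma prox_subdifferential h x (gamma : R) :
  proper_efun h -> convex_efun h -> lower_semicontinuous h -> 0 < gamma ->
  subdifferential h (prox gamma h x) (gamma^-1 *: (x - prox gamma h x)).
Proof.
move=> hp hc hl gamma0.
have k0 : 0 < (2 * gamma)^-1 by rewrite invr_gt0 mulr_gt0.
have [p pmin] := prox_objective_argmin x hp hc hl k0.
have := argmin_subdifferential hp hc (xgetI 0 pmin).
by have -> : 2 * (2 * gamma)^-1 = gamma^-1 by rewrite invfM mulrA divff ?mul1r.
Qed.

End Prox.

(** * Properness, convexity and lower semicontinuity of the conjugate *)

Section Conjugate.
Context {R : realType} {V : hilbertType R}.
Implicit Types (g : V -> \bar R) (u z : V).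

Lemma conjugate_ge g u z (r : R) :
  g z = r%:E -> ((inner u z - r)%:E <= conjugate g u)%E.
Proof. by move=> gz; apply: ereal_sup_ubound; exists z; rewrite ?gz. Qed.

(** Points where [g] is [+oo] contribute [-oo] to the supremum, so it suffices to test finite
    values. *)
Lemma conjugate_le g u c : (forall z, g z != -oo%E) ->
  (forall z r, g z = r%:E -> ((inner u z - r)%:E <= c)%E) ->
  (conjugate g u <= c)%E.
Proof.
move=> gNy le_c; apply: ge_ereal_sup => _ [z _ <-].
case gz: (g z) => [r||]; last by have := gNy z; rewrite gz.
  exact: le_c.
by rewrite addeNy leNye.
Qed.

Lemma conjugate_proper g : proper_efun g -> convex_efun g ->
  lower_semicontinuous g -> proper_efun (conjugate g).
Proof.
move=> gp gc gl; split.
  have [z [r gz]] := proper_efun_point gp => u.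
  by rewrite gt_eqF// (lt_le_trans (ltNyr _) (conjugate_ge u gz)).
have := prox_subdifferential 0 gp gc gl (@ltr01 R).
set p := prox 1 g 0; set u := _ *: _ => hu.
have /fineK pr := subdifferential_fin_num gp hu.
exists u; rewrite lt_eqF// (@le_lt_trans _ _ (inner u p - fine (g p))%:E) ?ltry//.
apply: conjugate_le => [|z r gz]; first exact: gp.1.
have := hu z; rewrite gz -pr -EFinD !lee_fin innerDr innerNr /=; lra.
Qed.

Lemma conjugate_convex g : proper_efun g -> convex_efun (conjugate g).
Proof.
move=> gp u w t /andP[t0 t1]; apply: conjugate_le => [|z r gz]; first exact: gp.1.
apply: le_trans (leeD (lee_wpmul2l _ (conjugate_ge u gz))
                      (lee_wpmul2l _ (conjugate_ge w gz))); last 2 first.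
- by rewrite lee_fin.
- by rewrite lee_fin subr_ge0.
rewrite -!EFinM -EFinD lee_fin !innerE le_eqVlt; apply/orP; left.
by apply/eqP; ring.
Qed.

Lemma conjugate_lsc g : lower_semicontinuous (conjugate g).
Proof.
move=> u a /ereal_sup_gt[_ [z _ <-]].
case gz: (g z) => [r||] //.
- rewrite -EFinB => az.
  have cont : continuous (fun w => inner w z - r).
    move=> w; apply: cvgB; last exact: cvg_cst.
    exact: continuous_innerl.
  have [U Uu hU] := lower_semicontinuous_EFin cont az.
  by exists U => // w /hU /lt_le_trans; apply; exact: conjugate_ge.
(* If [g z] is [-oo], the conjugate is [+oo] everywhere. *)
- by move=> _; exists setT => [|w _]; [exact: filterT |
    rewrite (@lt_le_trans _ _ +oo%E) ?ltry//; apply: ereal_sup_ubound;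
    exists z; rewrite ?gz].
Qed.

End Conjugate.

(** * Adjoint and operator norm *)

Section Adjoint.
Context {R : realType} {H G : hilbertType R} (L : {linear H -> G}).
Hypothesis L_bounded : bounded_near L (nbhs (0 : H)).

Lemma inner_adjoint x y : inner (L x) y = inner x (adjoint L y).
Proof.
(* The prox [p] of this functional at 0 has [- p] as a subgradient, hence <L w, y> <= <w, p> for all
   [w]; replacing [w] by [- w] gives equality. *)
pose h (z : H) := (- inner (L z) y)%:E.
have hp : proper_efun h by split => //; exists 0.
have hc : convex_efun h.
  move=> u w t _; rewrite /h -!EFinM -EFinD lee_fin linearD !linearZ /= !innerE.
  by rewrite le_eqVlt; apply/orP; left; apply/eqP; ring.
have hl : lower_semicontinuous h.
  apply: lower_semicontinuous_EFin => z; apply: cvgN.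
  apply: (@continuous_comp _ _ _ L (inner ^~ y)).
    exact: bounded_linear_continuous.
  exact: continuous_innerl.
have := prox_subdifferential 0 hp hc hl (@ltr01 R).
set p := prox 1 h 0; rewrite invr1 scale1r add0r => hsub.
have le_p w : inner (L w) y <= inner w p.
  have := hsub (p + w); rewrite [p + w - p]addrAC subrr add0r.
  by rewrite /h -EFinD lee_fin [L (p + w)]linearD !innerE (innerC p); lra.
suff /(xgetI 0) : [set z | forall x, inner (L x) y = inner x z] p by exact.
move=> w /=; apply/eqP; rewrite eq_le le_p /=.
by have := le_p (- w); rewrite linearN !innerE lerN2.
Qed.

Lemma le_opnorm x : `|L x| <= opnorm L * `|x|.
Proof.
have [M [_ /(_ (M + 1))]] := (linear_boundedP L).1 L_bounded.
rewrite ltrDl => /(_ ltr01) leM.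
(* Ensures that the [sup] in [opnorm] is a genuine supremum. *)
have Lub : has_ubound [set `|L x| | x in [set x | `|x| <= 1]].
  exists `|M + 1| => _ [z /= z1 <-]; apply: le_trans (leM z) _.
  by apply: (@le_trans _ _ (`|M + 1| * `|z|)); rewrite ?ler_wpM2r ?ler_norm ?ler_piMr.
have [->|x0] := eqVneq x 0; first by rewrite linear0 !normr0 mulr0.
have xn : 0 < `|x| by rewrite normr_gt0.
rewrite -ler_pdivrMr//; apply: (ub_le_sup Lub).
exists (`|x|^-1 *: x) => /=; first by rewrite normrZ normfV normr_id mulVf ?gt_eqF.
by rewrite linearZ /= normrZ normfV normr_id mulrC.
Qed.

(** [adjoint] is chosen separately for each vector, so additivity has to be derived: the defect is
    orthogonal to itself. *)
Lemma adjointB y z : adjoint L (y - z) = adjoint L y - adjoint L z.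
Proof.
apply/eqP; rewrite -subr_eq0 -normr_eq0 -sqrf_eq0 -inner_norm; apply/eqP.
set d := _ - (_ - _).
rewrite [X in inner _ X](_ : _ = adjoint L (y - z) - (adjoint L y - adjoint L z))//.
by rewrite !innerDr !innerNr !innerDr !innerNr -!inner_adjoint innerDr innerNr; ring.
Qed.

(** |L^* y|^2 = <L L^* y, y> <= |L| |L^* y| |y|, and one factor |L^* y| cancels. *)
Lemma sqr_norm_adjoint y :
  inner (adjoint L y) (adjoint L y) <= opnorm L ^+ 2 * inner y y.
Proof.
have [->|z0] := eqVneq (adjoint L y) 0.
  by rewrite inner_norm normr0 expr0n mulr_ge0 ?sqr_ge0 ?inner_ge0.
have zn : 0 < `|adjoint L y| by rewrite normr_gt0.
rewrite !inner_norm -exprMn lerXn2r ?nnegrE//.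
  by rewrite mulr_ge0// -(pmulr_lge0 _ zn) (le_trans _ (le_opnorm _)).
rewrite -(ler_pM2l zn) -expr2 -inner_norm -inner_adjoint.
apply: le_trans (ler_norm _) _; apply: le_trans (cauchy_schwarz _ _) _.
by rewrite mulrA ler_wpM2r// mulrC le_opnorm.
Qed.

End Adjoint.

(** * Ergodic means and Jensen's inequality *)

Section Ergodic.
Context {R : realType} {V : hilbertType R}.
Implicit Types (h : V -> \bar R).

Lemma ergodic_meanS (x : nat -> V) (K : nat) : (0 < K)%N ->
  ergodic_mean x K.+1 = (K%:R / K.+1%:R) *: ergodic_mean x K
                        + (1 - K%:R / K.+1%:R) *: x K.+1.
Proof.
move=> K0; rewrite /ergodic_mean big_nat_recr//= scalerDr scalerA.
have K0' : K%:R != 0 :> R by rewrite pnatr_eq0 -lt0n.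
have K1 : K%:R + 1 != 0 :> R by rewrite natr1 pnatr_eq0.
congr (_ *: _ + _ *: _); first by rewrite mulrAC divff// mul1r.
by rewrite -natr1; field.
Qed.

Lemma ergodic_mean_jensen h (x : nat -> V) (a : nat -> R) (K : nat) :
  convex_efun h -> (forall k, (h (x k.+1) <= (a k.+1)%:E)%E) -> (0 < K)%N ->
  (h (ergodic_mean x K) <= (K%:R^-1 * \sum_(1 <= k < K.+1) a k)%:E)%E.
Proof.
move=> hc ha; elim: K => // K IH _; case: (posnP K) => [->|K0].
  by rewrite /ergodic_mean !big_nat1 invr1 scale1r mul1r.
have K0' : K%:R != 0 :> R by rewrite pnatr_eq0 -lt0n.
have K1 : K%:R + 1 != 0 :> R by rewrite natr1 pnatr_eq0.
rewrite ergodic_meanS//; apply: le_trans (convex_efun_fin hc _ (IH K0) (ha K)) _.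
  by rewrite divr_ge0//= ler_pdivrMr// mul1r ler_nat.
rewrite lee_fin (big_nat_recr K.+1)//= le_eqVlt; apply/orP; left; apply/eqP.
by rewrite -natr1; field; rewrite K1.
Qed.

(** Tailored to the two parts of the gap, each a convex function plus an affine real one; finiteness
    at the mean makes [fine] faithful there. *)
Lemma ergodic_mean_jensen_fine h (phi : V -> R) (x : nat -> V) (K : nat) :
  proper_efun h -> convex_efun h ->
  (forall u w t, phi (t *: u + (1 - t) *: w) = t * phi u + (1 - t) * phi w) ->
  (forall k, h (x k.+1) \is a fin_num) -> (0 < K)%N ->
  h (ergodic_mean x K) \is a fin_num /\
  fine (h (ergodic_mean x K)) + phi (ergodic_mean x K)
    <= K%:R^-1 * \sum_(1 <= k < K.+1) (fine (h (x k)) + phi (x k)).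
Proof.
move=> hp hc aff hx K0.
have hle k : (h (x k.+1) <= (fine (h (x k.+1)))%:E)%E by rewrite fineK.
have phic : convex_efun (fun u => (phi u)%:E).
  by move=> u w t _; rewrite -!EFinM -EFinD aff.
have h_mean := ergodic_mean_jensen (a := fun k => fine (h (x k))) hc hle K0.
have phi_mean := ergodic_mean_jensen (a := phi \o x) phic (fun k => lexx _) K0.
have fin : h (ergodic_mean x K) \is a fin_num.
  by have := hp.1 (ergodic_mean x K); move: h_mean; case: (h _).
split=> //; rewrite big_split /= mulrDr; apply: lerD.
  by rewrite -lee_fin fineK.
by rewrite -lee_fin.
Qed.

Lemma subdifferential_fine h p u z : proper_efun h -> subdifferential h p u ->
  h z \is a fin_num -> fine (h p) + inner u (z - p) <= fine (h z).
Proof.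
move=> hp hu /fineK hz; have := hu z.
by rewrite -(fineK (subdifferential_fin_num hp hu)) -hz -EFinD lee_fin.
Qed.

End Ergodic.

(** * Nonnegativity and descent of the Lyapunov function *)

Section Lyapunov.
Context {R : realType} {H G : hilbertType R} (tau sigma theta : R).
Hypotheses (tau_gt0 : 0 < tau) (sigma_gt0 : 0 < sigma) (theta_ge : 1 / 2 <= theta).

(* [x0], [x1] are consecutive primal iterates relative to [xs], [a0], [a1] the
   images under [L^*] of the dual iterates relative to [ys], [y1] the second of
   the latter, and [F1] the primal part of the gap at [x1]. *)
Definition lyapunov (x0 x1 a0 a1 : H) (y1 : G) (F1 : R) : R :=
  (2 * tau)^-1 * inner x1 x1 + (2 * sigma)^-1 * inner y1 y1 - inner x1 a1
  + (theta - 1) * F1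
  + tau / 4 * inner (tau^-1 *: (x1 - x0) - (a1 - a0)) (tau^-1 *: (x1 - x0) - (a1 - a0)).

Lemma lyapunov_ge0 (x0 x1 a0 a1 : H) (y1 : G) (F1 : R) :
  tau * sigma * inner a1 a1 <= 2 * inner y1 y1 -> 0 <= F1 ->
  F1 <= inner (tau^-1 *: (x0 - x1) - a0) x1 ->
  0 <= lyapunov x0 x1 a0 a1 y1 F1.
Proof.
move=> a1_le F1_ge0 F1_le; pose w := tau^-1 *: (x1 - x0) - (a1 - a0).
(* The two squares produce |x1|^2 / (2 tau) and, with the first summand, the cross term -<x1, a1>;
   their surplus tau |a1|^2 / 4 is paid for by the |y1|^2 term. *)
have -> : lyapunov x0 x1 a0 a1 y1 F1 =
  (inner (tau^-1 *: (x0 - x1) - a0) x1 - F1) / 2 + (theta - 1 / 2) * F1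
  + tau / 4 * (inner (w + tau^-1 *: x1) (w + tau^-1 *: x1)
               + inner (tau^-1 *: x1 - a1) (tau^-1 *: x1 - a1))
  + (2 * inner y1 y1 - tau * sigma * inner a1 a1) / (4 * sigma).
  rewrite /lyapunov /w !innerE ?(innerC x1 x0, innerC a0 x0, innerC a1 x0).
  rewrite ?(innerC a0 x1, innerC a1 x1, innerC a1 a0).
  by field; rewrite !gt_eqF.
apply: addr_ge0; first apply: addr_ge0; first apply: addr_ge0.
all: by rewrite ?mulr_ge0 ?(addr_ge0 (inner_ge0 _)) ?invr_ge0 ?mulr_ge0 ?subr_ge0
  ?inner_ge0 ?(ltW tau_gt0) ?(ltW sigma_gt0).
Qed.

Lemma lyapunov_descent (x0 x1 x2 a0 a1 a2 : H) (y1 y2 : G) (F1 F2 G2 : R) :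
  tau * sigma * inner (a2 - a1) (a2 - a1) * (1 + 2 * theta)
    <= 4 * inner (y2 - y1) (y2 - y1) ->
  F2 <= inner (tau^-1 *: (x1 - x2) - a1) x2 ->
  G2 <= inner (sigma^-1 *: (y1 - y2)) y2 + inner (x2 + theta *: (x2 - x1)) a2 ->
  F2 + inner (tau^-1 *: (x1 - x2) - a1) (x1 - x2) <= F1 ->
  F1 + inner (tau^-1 *: (x0 - x1) - a0) (x2 - x1) <= F2 ->
  F2 + G2 <= lyapunov x0 x1 a0 a1 y1 F1 - lyapunov x1 x2 a1 a2 y2 F2.
Proof.
move=> step F2_le G2_le F12 F21.
pose c := tau^-1 *: (x2 - x1).
pose w := tau^-1 *: (x1 - x0) - (a1 - a0).
rewrite -subr_ge0.
(* The four inequalities enter with weights 1, 1, theta - 1/2 and 1/2. What remains is two squares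
   and a |a2 - a1|^2 deficit that the step-size condition covers by |y2 - y1|^2. *)
have -> : lyapunov x0 x1 a0 a1 y1 F1 - lyapunov x1 x2 a1 a2 y2 F2 - (F2 + G2) =
  (inner (tau^-1 *: (x1 - x2) - a1) x2 - F2)
  + (inner (sigma^-1 *: (y1 - y2)) y2 + inner (x2 + theta *: (x2 - x1)) a2 - G2)
  + (theta - 1 / 2) * (F1 - (F2 + inner (tau^-1 *: (x1 - x2) - a1) (x1 - x2)))
  + (F2 - (F1 + inner (tau^-1 *: (x0 - x1) - a0) (x2 - x1))) / 2
  + tau / 4 * inner (c - w) (c - w)
  + (theta - 1 / 2) * tau
    * inner (c - 2^-1 *: (a2 - a1)) (c - 2^-1 *: (a2 - a1))
  + (4 * inner (y2 - y1) (y2 - y1)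
     - tau * sigma * inner (a2 - a1) (a2 - a1) * (1 + 2 * theta)) / (8 * sigma).
  rewrite /lyapunov /w /c !innerE.
  rewrite ?(innerC x1 x0, innerC x2 x0, innerC x2 x1, innerC y2 y1).
  rewrite ?(innerC a0 x0, innerC a0 x1, innerC a0 x2, innerC a1 x0, innerC a1 x1).
  rewrite ?(innerC a1 x2, innerC a2 x0, innerC a2 x1, innerC a2 x2).
  rewrite ?(innerC a1 a0, innerC a2 a0, innerC a2 a1).
  by field; rewrite !gt_eqF.
apply: addr_ge0; first apply: addr_ge0; first apply: addr_ge0;
  first apply: addr_ge0; first apply: addr_ge0; first apply: addr_ge0.
all: by rewrite ?mulr_ge0 ?(addr_ge0 (inner_ge0 _)) ?invr_ge0 ?mulr_ge0 ?subr_ge0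
  ?inner_ge0 ?(ltW tau_gt0) ?(ltW sigma_gt0).
Qed.

End Lyapunov.

(** * Splitting the gap into primal and dual parts *)

Section GapParts.
Context {R : realType} {H G : hilbertType R}.
Variables (f : H -> \bar R) (g : G -> \bar R) (L : {linear H -> G}).
Variables (xs : H) (ys : G).

(** Adding and subtracting <L xs, ys> decouples the gap. Where [f] is finite this is f(x) - f(xs) -
    <-L^* ys, x - xs>, grouped as [fine] plus an affine function for Jensen. *)
Definition primal_gap (x : H) : R :=
  fine (f x) + (inner (L (x - xs)) ys - fine (f xs)).

Definition dual_gap (y : G) : R :=
  fine (conjugate g y) + (- inner (L xs) (y - ys) - fine (conjugate g ys)).

Lemma pd_gap_fine x y :
  f xs \is a fin_num -> conjugate g ys \is a fin_num ->
  f x \is a fin_num -> conjugate g y \is a fin_num ->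
  pd_gap f g L xs ys x y = (primal_gap x + dual_gap y)%:E.
Proof.
move=> /fineK fxs /fineK gys /fineK fx /fineK gy.
rewrite /pd_gap /lagrangian -fxs -gys -fx -gy.
apply: (congr1 EFin); rewrite /primal_gap /dual_gap [L (x - xs)]linearB !innerE.
by rewrite (innerC ys) (innerC y); ring.
Qed.

Hypothesis f_proper : proper_efun f.
Hypothesis g_proper : proper_efun (conjugate g).
Hypothesis L_bounded : bounded_near L (nbhs (0 : H)).
Hypothesis kkt : kkt_point f g L xs ys.

Lemma primal_gap_ge0 x : f x \is a fin_num -> 0 <= primal_gap x.
Proof.
move=> fx; have := subdifferential_fine f_proper kkt.1 fx.
rewrite innerNl innerC -(inner_adjoint L_bounded) /primal_gap; lra.
Qed.

Lemma dual_gap_ge0 y : conjugate g y \is a fin_num -> 0 <= dual_gap y.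
Proof.
move=> gy; have := subdifferential_fine g_proper kkt.2 gy.
rewrite /dual_gap; lra.
Qed.

End GapParts.

(** * Telescoping along the iteration and the ergodic rate *)

Theorem theorem1 (R : realType) (H G : hilbertType R)
    (f : H -> \bar R) (g : G -> \bar R) (L : {linear H -> G})
    (f_proper : proper_efun f) (f_convex : convex_efun f) (f_lsc : lower_semicontinuous f)
    (g_proper : proper_efun g) (g_convex : convex_efun g) (g_lsc : lower_semicontinuous g)
    (L_bounded : bounded_near L (nbhs (0 : H)))
    (L_nonzero : exists x : H, L x != 0)
    (xs : H) (ys : G) (kkt : kkt_point f g L xs ys)
    (theta tau sigma : R)
    (theta_ge : 1 / 2 <= theta) (tau_gt0 : 0 < tau) (sigma_gt0 : 0 < sigma)
    (step_le : tau * sigma * opnorm L ^+ 2 <= 4 / (1 + 2 * theta))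
    (one_strict : 1 / 2 < theta \/
                  tau * sigma * opnorm L ^+ 2 < 4 / (1 + 2 * theta))
    (x : nat -> H) (y : nat -> G)
    (iter_xy : chambolle_pock f g L tau sigma theta x y) :
  exists2 C : R, 0 <= C & forall K : nat, (0 < K)%N ->
    (0 <= pd_gap f g L xs ys (ergodic_mean x K) (ergodic_mean y K)
       <= (C / K%:R)%:E)%E.
Proof.
have gs_proper := conjugate_proper g_proper g_convex g_lsc.
have gs_convex := conjugate_convex g_proper.
have gs_lsc := @conjugate_lsc _ _ g.
have adj := inner_adjoint L_bounded.
have adjB := adjointB L_bounded.
(* Optimality conditions of the two proximal steps; the iteration enters only through them. *)
have sub_x k : subdifferential f (x k.+1)
    (tau^-1 *: (x k - x k.+1) - adjoint L (y k)).
  have [xE _] := iter_xy k.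
  have := prox_subdifferential (x k - tau *: adjoint L (y k)) f_proper f_convex f_lsc tau_gt0.
  rewrite -xE (addrAC (x k)) (scalerBr _ (x k - x k.+1)) scalerA mulVf ?gt_eqF//.
  by rewrite scale1r.
have sub_y k : subdifferential (conjugate g) (y k.+1)
    (sigma^-1 *: (y k - y k.+1) + L (x k.+1 + theta *: (x k.+1 - x k))).
  have [_ yE] := iter_xy k.
  have := prox_subdifferential (y k + sigma *: L (x k.+1 + theta *: (x k.+1 - x k)))
    gs_proper gs_convex gs_lsc sigma_gt0.
  rewrite -yE (addrAC (y k)) (scalerDr _ (y k - y k.+1)) scalerA mulVf ?gt_eqF//.
  by rewrite scale1r.
have fxs_fin := subdifferential_fin_num f_proper kkt.1.
have gys_fin := subdifferential_fin_num gs_proper kkt.2.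
have fx_fin k := subdifferential_fin_num f_proper (sub_x k).
have gy_fin k := subdifferential_fin_num gs_proper (sub_y k).
(* The step-size condition carried over to the adjoint, for both descent and nonnegativity of
   [v]. *)
have adj_step b : tau * sigma * inner (adjoint L b) (adjoint L b) * (1 + 2 * theta)
    <= 4 * inner b b.
  have theta1 : 0 < 1 + 2 * theta by lra.
  rewrite ler_pdivlMr// in step_le.
  have c0 : 0 <= tau * sigma * (1 + 2 * theta) by rewrite !mulr_ge0// ltW.
  have := ler_wpM2l c0 (sqr_norm_adjoint L_bounded b).
  have := ler_wpM2r (inner_ge0 b) step_le; lra.
pose P k := primal_gap f L xs ys (x k).
pose Q k := dual_gap g L xs ys (y k).
pose X k := x k - xs; pose Y k := y k - ys.
pose A k := adjoint L (Y k).
have AE k : A k = adjoint L (y k) - adjoint L ys by exact: adjB.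
have XB i j : X i - X j = x i - x j by rewrite /X opprB addrA subrK.
have YB i j : Y i - Y j = y i - y j by rewrite /Y opprB addrA subrK.
pose v k := lyapunov tau sigma theta (X k) (X k.+1) (A k) (A k.+1) (Y k.+1) (P k.+1).
have P_ge0 k : 0 <= P k.+1 by exact: (primal_gap_ge0 f_proper L_bounded kkt).
have Q_ge0 k : 0 <= Q k.+1 by exact: (dual_gap_ge0 gs_proper kkt).
have P_le k : P k.+1 <= inner (tau^-1 *: (X k - X k.+1) - A k) (X k.+1).
  have := subdifferential_fine f_proper (sub_x k) fxs_fin.
  rewrite /P /primal_gap adj XB AE /X !innerE (innerC (adjoint L ys)).
  rewrite (innerC (adjoint L ys)); lra.
have Q_le k : Q k.+1 <= inner (sigma^-1 *: (Y k - Y k.+1)) (Y k.+1)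
    + inner (X k.+1 + theta *: (X k.+1 - X k)) (A k.+1).
  have := subdifferential_fine gs_proper (sub_y k) gys_fin.
  rewrite /Q /dual_gap XB YB -adj [in L (X _ + _)]/X.
  rewrite addrAC [L (_ - xs)]linearB /Y !innerE; lra.
have v_ge0 k : 0 <= v k.
  apply: lyapunov_ge0 => //.
  (* Since 1 + 2 theta >= 2, this yields the bound with constant 2. *)
  have := adj_step (Y k.+1); rewrite -/(A k.+1) => h.
  have := ler_wpM2l (mulr_ge0 (mulr_ge0 (ltW tau_gt0) (ltW sigma_gt0))
    (inner_ge0 (A k.+1))) theta_ge; lra.
(* Starts at index 2: subgradients at two consecutive iterates are needed, and [x 0] comes with
   none. The gap at index 1 therefore goes into [C]. *)
have descent k : P k.+2 + Q k.+2 <= v k - v k.+1.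
  apply: lyapunov_descent => //.
  - by rewrite /A -adjB.
  - have := subdifferential_fine f_proper (sub_x k.+1) (fx_fin k).
    rewrite /P /primal_gap !adj !XB AE /X !innerE.
    rewrite !(innerC (adjoint L ys)); lra.
  - have := subdifferential_fine f_proper (sub_x k) (fx_fin k.+1).
    rewrite /P /primal_gap !adj !XB AE /X !innerE.
    rewrite !(innerC (adjoint L ys)); lra.
pose C := P 1%N + Q 1%N + v 0%N.
have sum_le K : \sum_(1 <= k < K.+2) (P k + Q k) + v K <= C.
  elim: K => [|K IH]; first by rewrite big_nat1.
  by rewrite big_nat_recr//=; have := descent K; lra.
exists C => [|[//|K] _]; first exact: addr_ge0 (addr_ge0 (P_ge0 0%N) (Q_ge0 0%N)) (v_ge0 0%N).
(* The affine parts of [primal_gap] and [dual_gap]. *)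
pose phi u := inner (L (u - xs)) ys - fine (f xs).
pose psi w := - inner (L xs) (w - ys) - fine (conjugate g ys).
have phi_affine u w t : phi (t *: u + (1 - t) *: w) = t * phi u + (1 - t) * phi w.
  by rewrite /phi !(adj (_ - xs)) !innerE; ring.
have psi_affine u w t : psi (t *: u + (1 - t) *: w) = t * psi u + (1 - t) * psi w.
  by rewrite /psi !innerE; ring.
have [f_mean f_le] :=
  ergodic_mean_jensen_fine f_proper f_convex phi_affine fx_fin (ltn0Sn K).
have [g_mean g_le] :=
  ergodic_mean_jensen_fine gs_proper gs_convex psi_affine gy_fin (ltn0Sn K).
rewrite pd_gap_fine// !lee_fin addr_ge0/=; last 2 first.
- exact: (primal_gap_ge0 f_proper L_bounded kkt).
- exact: (dual_gap_ge0 gs_proper kkt).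
apply: le_trans (lerD f_le g_le) _.
rewrite -mulrDr -big_split /= mulrC ler_pM2r ?invr_gt0//.
by have := v_ge0 K; have := sum_le K; rewrite /P /Q /primal_gap /dual_gap; lra.
Qed.
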